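(* Let $\epsilon>0$ be real, let $N>k\ge 1$ be integers, and put $R=\frac{k}{N}$. Let $\mathbb{F}_q$ be a finite field with $q>N$ and let $\gamma$ be a generator of $\mathbb{F}_q^\times$. Let $L\ge 1$ be an integer with $L>\frac{1-R-\epsilon}{\epsilon}$, and let $s\ge1$ be an integer with $s\mid N$ and $$s>\frac{L(L-1)R}{\epsilon L-(1-R-\epsilon)}+L-1.$$ Let $n=\frac{N}{s}$ and let $(\alpha_1,\dots,\alpha_n)\in\mathbb{F}_q^n$ be appropriate. Then the folded Reed--Solomon code $\mathsf{FRS}_{n,k}^{(s,\gamma)}(\alpha_1,\dots,\alpha_n)$ over the alphabet $\mathbb{F}_q^s$ is $(1-R-\epsilon,L)$ list-decodable. Therefore, by choosing different folding parameters $s$, the folded Reed--Solomon code $\mathsf{FRS}_{n,k}^{(s,\gamma)}(\alpha_1,\dots,\alpha_n)$ is: (a) $\left(1-R-\epsilon,\lfloor\frac{1-R}{\epsilon}\rfloor\right)$ list-decodable, when $s>\widetilde{s}$, where $\widetilde{s}$ is some constant depending only on $R$ and $\epsilon$; (b) $\left(1-R-\epsilon,\lceil\frac{1-R}{\epsilon}\rceil\right)$ list-decodable, when $s=\Theta(1/\epsilon^3)$; (c) $\left(1-R-\epsilon,\lceil\frac{1}{\epsilon}\rceil\right)$ list-decodable, when $s=\Theta(1/\epsilon^2)$.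
   Context: Appropriate: $(\alpha_1,\dots,\alpha_n)\in\mathbb{F}_q^n$ is appropriate (with respect to $s$ and the generator $\gamma$) if the $sn$ elements $\gamma^i\alpha_j$, $i\in\{0,\dots,s-1\}$, $j\in\{1,\dots,n\}$, are pairwise distinct. Folded Reed--Solomon code: $\mathsf{FRS}^{(s,\gamma)}_{n,k}(\alpha_1,\dots,\alpha_n)=\{\mathcal{C}(f): f\in\mathbb{F}_q[x],\ \deg f<k\}\subseteq(\mathbb{F}_q^s)^n$, where $\mathcal{C}(f)=(F_1,\dots,F_n)$ and $F_i=(f(\alpha_i),f(\gamma\alpha_i),\dots,f(\gamma^{s-1}\alpha_i))\in\mathbb{F}_q^s$. Its rate is $R=\frac{k}{sn}=\frac{k}{N}$, and $s$ is called the folding parameter. List-decodability: a code $C\subseteq\Sigma^n$ is $(\rho,L)$ list-decodable if for every $y\in\Sigma^n$ there are at most $L$ codewords $c\in C$ that differ from $y$ in at most a $\rho$ fraction of the $n$ coordinates. *)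

(* Defs.v *)
From HB Require Import structures.
From mathcomp Require Import all_boot all_order all_algebra.
From mathcomp Require Import all_fingroup all_solvable.
From mathcomp Require Import reals.

Set Implicit Arguments.
Unset Strict Implicit.
Unset Printing Implicit Defensive.

Import Order.TTheory GRing.Theory Num.Theory.
Local Open Scope ring_scope.

(* rho may be negative, in which case no codeword is counted.  The list size L
   is an integer so that it can be the floor or ceiling of a real. *)
Definition list_decodable (R : realType) (n : nat) (Sigma : finType)
    (C : {set {ffun 'I_n -> Sigma}}) (rho : R) (L : int) : Prop :=
  forall y : {ffun 'I_n -> Sigma},
    (#|[set c in C | #|[set i | c i != y i]|%:R <= rho * n%:R]|%:Z <= L)%R.

Definition appropriate (F : finFieldType) (s n : nat) (gamma : {unit F})
    (alpha : 'I_n -> F) : Prop :=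
  injective (fun p : 'I_s * 'I_n => val gamma ^+ p.1 * alpha p.2).

Definition FRS_encode (F : finFieldType) (s n : nat) (gamma : {unit F})
    (alpha : 'I_n -> F) (f : {poly F}) : {ffun 'I_n -> 'rV[F]_s} :=
  [ffun j => \row_(i < s) f.[val gamma ^+ i * alpha j]].

(* {poly_k F} consists of the polynomials of size at most k, i.e. deg f < k. *)
Definition FRS (F : finFieldType) (s n k : nat) (gamma : {unit F})
    (alpha : 'I_n -> F) : {set {ffun 'I_n -> 'rV[F]_s}} :=
  [set FRS_encode s gamma alpha (val f) | f : {poly_k F}].

Definition rate (R : realType) (N k : nat) : R := k%:R / N%:R.

Definition FRS_setting (N k s : nat) (F : finFieldType) (gamma : {unit F})
    (alpha : 'I_(N %/ s) -> F) : Prop :=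
  [/\ (1 <= k < N)%N,
      (1 <= s)%N /\ (s %| N)%N,
      (N < #|F|)%N,
      generator [set: {unit F}] gamma
    & appropriate s gamma alpha].

(* Main.v *)
Require Import Defs.
From HB Require Import structures.
From mathcomp Require Import all_boot all_order all_algebra.
From mathcomp Require Import all_fingroup all_solvable.
From mathcomp Require Import reals.
From mathcomp Require Import zify ring lra.

Set Implicit Arguments.
Unset Strict Implicit.
Unset Printing Implicit Defensive.

Import Order.TTheory GRing.Theory Num.Theory.
Local Open Scope ring_scope.

(* Suppose L + 1 polynomials of degree < k have encodings close to y, and let e_i
   be the set of those agreeing with y on block i.  Everything follows from the
   bound (s - L + 1) sum_i max(|e_i| - 1, 0) <= L (k - 1), proved by induction on
   the number of polynomials.  Let d be the dimension of their affine span.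
   Cutting along a full flag of affine subspaces spanned by some of them splits
   them into d + 1 nonempty levels, to which induction applies; what is left
   counts, for each block, the levels met by e_i, minus one.  This number is at
   most the dimension of the space of differences vanishing on block i, hence at
   most the order of vanishing of the folded Wronskian of the span at each of
   s - d + 1 points, and the Wronskian is a nonzero polynomial of degree at most
   d (k - 1). *)

(** * Preliminaries on polynomials, determinants and bases *)

Lemma coef_comp_scaleX (A : comNzRingType) (p : {poly A}) (c : A) i :
  (p \Po (c *: 'X))`_i = p`_i * c ^+ i.
Proof.
rewrite coef_comp_poly.
under eq_bigr => j _ do rewrite exprZn coefZ coefXn.
have [ltip|leip] := ltnP i (size p).
  rewrite (bigD1 (Ordinal ltip)) //= eqxx mulr1 big1 ?addr0 // => j.
  by rewrite -val_eqE /= eq_sym => /negPf->; rewrite !mulr0.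
rewrite nth_default // mul0r big1 // => j _.
by rewrite [i == _]gtn_eqF ?mulr0 // (leq_trans _ leip).
Qed.

Lemma coefM_top (A : nzRingType) (p q : {poly A}) a b :
  (size p <= a.+1)%N -> (size q <= b.+1)%N -> (p * q)`_(a + b) = p`_a * q`_b.
Proof.
move=> sp sq; rewrite coefM.
have lta : (a < (a + b).+1)%N by rewrite ltnS leq_addr.
rewrite (bigD1 (Ordinal lta)) //= addKn big1 ?addr0 // => j.
rewrite -val_eqE /= neq_ltn => /orP[ltja|ltaj].
  by rewrite [q`_ _]nth_default ?mulr0 //; apply: leq_trans sq _; lia.
by rewrite nth_default ?mul0r // (leq_trans sp).
Qed.

(** Every term of the Leibniz expansion contains one factor from each row in [T]. *)
Lemma dvdp_det_rows (F : fieldType) d (A : 'M[{poly F}]_d) (T : {set 'I_d})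
    (p : {poly F}) :
  (forall i j, i \in T -> p %| A i j) -> p ^+ #|T| %| \det A.
Proof.
move=> dvdA; apply: (big_ind (fun q => p ^+ #|T| %| q)) => [|q r|sg _].
- exact: dvdp0.
- exact: dvdp_add.
rewrite dvdp_mull // (bigID (mem T)) /= dvdp_mulr // -prodr_const.
apply: (big_ind2 (fun q r => q %| r)) => // [q q2 r r2|i iT]; first exact: dvdp_mul.
exact: dvdA.
Qed.

Lemma size_det_leq (F : fieldType) d k (A : 'M[{poly F}]_d) :
  (forall i j, (size (A i j) <= k.+1)%N) -> (size (\det A) <= (d * k).+1)%N.
Proof.
move=> sA; rewrite /determinant.
apply: (big_ind (fun q : {poly F} => size q <= (d * k).+1)%N)
  => [|q r sq sr|sg _].
- by rewrite size_poly0.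
- by rewrite (leq_trans (size_polyD _ _)) // geq_max sq.
rewrite mulr_sign.
have -> (c : bool) (q : {poly F}) : size (if c then - q else q) = size q.
  by case: c; rewrite ?size_polyN.
apply: leq_trans (size_poly_prod_leq _ _) _.
have -> : #|[pred _ : 'I_d | true]| = d by rewrite cardT size_enum_ord.
have : (\sum_(i < d) size (A i (sg i)) <= \sum_(i < d) k.+1)%N.
  by apply: leq_sum.
rewrite sum_nat_const card_ord mulnS => le_sum.
by rewrite leq_subLR addnS ltnS.
Qed.

Lemma prod_exp_XsubC_dvdp (F : fieldType) (I : finType) (z : I -> F)
    (r : I -> nat) (p : {poly F}) :
  injective z -> (forall i, ('X - (z i)%:P) ^+ r i %| p) ->
  \prod_i ('X - (z i)%:P) ^+ r i %| p.
Proof.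
move=> injz dvdp.
elim: (index_enum I) (index_enum_uniq I) => [|i e IHe] /=.
  by rewrite big_nil dvd1p.
case/andP=> iNe uniqe; rewrite big_cons Gauss_dvdp ?dvdp ?IHe //.
apply: coprimep_expl; rewrite big_seq.
apply: (big_ind (fun q => coprimep _ q)) => [||j je].
- exact: coprimep1.
- by move=> q q' zq zq'; rewrite coprimepMr zq.
apply: coprimep_expr; rewrite coprimep_XsubC root_XsubC.
by apply: contra iNe => /eqP/injz <-.
Qed.

(** Drawing the basis from [X] itself is what later makes every level of the flag nonempty. *)
Lemma exists_free_span (K : fieldType) (vT : vectType K) (X : seq vT) :
  exists Y : seq vT, [/\ {subset Y <= X}, free Y & <<Y>>%VS = <<X>>%VS].
Proof.
elim: X => [|x X [Y [sYX freeY spanY]]]; first by exists [::]; rewrite nil_free.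
have [xX|xNX] := boolP (x \in <<X>>%VS).
  exists Y; split=> // [y /sYX yX|]; first by rewrite inE yX orbT.
  by rewrite spanY span_cons; apply/esym/addv_idPr; rewrite -memvE.
exists (x :: Y); split; last by rewrite !span_cons spanY.
  by move=> y; rewrite !inE => /orP[->//|/sYX->]; rewrite orbT.
by rewrite free_cons spanY xNX.
Qed.

(** * The folded Wronskian and its zeros at the evaluation points *)

(** Analogue of the Wronskian in which the dilation X -> g X replaces differentiation. *)
Definition folded_wronskian (F : fieldType) (g : F) d (b : 'I_d -> {poly F}) :
    'M[{poly F}]_d :=
  \matrix_(l, m) (b l \Po (g ^+ m *: 'X)).

(** A singular matrix would give a relation sum_m v_m f(g^m X) = 0 valid for all f in the span. Its
    top coefficients form a nonzero polynomial [Q] of degree below d, with root g^(deg f) for each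
    nonzero f. So fewer than d degrees occur in the span, against its dimension. *)
Lemma det_folded_wronskian_neq0 (F : fieldType) (g : F) k d
    (b : 'I_d -> {poly F}) :
  {in gtn k &, injective (GRing.exp g)} ->
  (forall l, (size (b l) <= k)%N) ->
  (forall u : 'I_d -> F, \sum_l u l *: b l = 0 -> forall l, u l = 0) ->
  \det (folded_wronskian g b) != 0.
Proof.
move=> injg sb freeb; apply/negP; rewrite -det_tr => /det0P[v vN0 vW].
pose D := \max_m size (v 0%R m).
have [m0 vm0] : exists m0, v 0 m0 != 0.
  apply/existsP; apply: contra_neqT vN0; rewrite negb_exists => /forallP v0.
  by apply/rowP => m; rewrite mxE; apply/eqP; rewrite -[_ == _]negbK.
have szD m : (size (v 0%R m) <= D)%N by rewrite /D; apply: (leq_bigmax m).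
have D_gt0 : (0 < D)%N by apply: leq_trans (szD m0); rewrite size_poly_gt0.
have [m1 Dm1] : exists m1, D = size (v 0%R m1).
  rewrite /D; have [|m1 _ ->] := @eq_bigmax_cond _ predT (fun m => size (v 0%R m)).
    by apply/card_gt0P; exists m0.
  by exists m1.
pose Q := rVpoly (\row_m (v 0 m)`_D.-1).
have szQ : (size Q <= d)%N by rewrite size_poly.
have QE m : Q`_(nat_of_ord m) = (v 0 m)`_D.-1 by rewrite coef_rVpoly_ord mxE.
have QN0 : Q != 0.
  apply/eqP => /polyP/(_ m1); rewrite QE coef0 Dm1 => /eqP.
  by rewrite -/(lead_coef _) lead_coef_eq0 -size_poly_eq0 -Dm1 -leqn0 leqNgt D_gt0.
(* Comparing top coefficients in sum_m v_m f(g^m X) = 0. *)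
have rootQ (u : 'I_d -> F) (f := \sum_l u l *: b l) :
    f != 0 -> root Q (g ^+ (size f).-1).
  move=> fN0; have szf : (0 < size f)%N by rewrite size_poly_gt0.
  have sum0 : \sum_m v 0 m * (f \Po (g ^+ m *: 'X)) = 0.
    rewrite /f; under eq_bigr => m _.
      rewrite raddf_sum mulr_sumr.
      under eq_bigr => l _ do rewrite /= comp_polyZ -scalerAr.
      over.
    rewrite exchange_big big1 // => l _; rewrite -scaler_sumr.
    move/rowP/(_ l): vW; rewrite !mxE => vWl.
    rewrite (_ : \sum_(_ < d) _ = 0) ?scaler0 // -[RHS]vWl.
    by apply: eq_bigr => m _; rewrite !mxE.
  have /polyP/(_ (D.-1 + (size f).-1)%N) := sum0.
  rewrite coef0 coef_sum => sumc0; apply/rootP; rewrite (horner_coef_wide _ szQ).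
  apply: (mulIf (_ : lead_coef f != 0)); first by rewrite lead_coef_eq0.
  rewrite mul0r mulr_suml -[RHS]sumc0; apply: eq_bigr => m _.
  rewrite coefM_top ?prednK //; last first.
    by apply/leq_sizeP => j lej; rewrite coef_comp_scaleX nth_default ?mul0r.
  by rewrite coef_comp_scaleX QE exprAC lead_coefE -mulrA [_ * lead_coef f]mulrC.
pose S := [set c : 'I_k | root Q (g ^+ c)].
have ltSd : (#|S| < d)%N.
  have := @max_poly_roots _ Q [seq g ^+ (nat_of_ord c) | c <- enum S] QN0.
  rewrite size_map -cardE => ltSQ; apply: leq_trans szQ; apply: ltSQ.
    by apply/allP => _ /mapP[c + ->]; rewrite mem_enum inE.
  rewrite map_inj_in_uniq ?enum_uniq // => c c' _ _ /injg eqc.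
  by apply: val_inj; apply: eqc; rewrite inE.
pose A := \matrix_(l < d, c < #|S|) (b l)`_(enum_val c).
(* Fewer conditions than unknowns: some nonzero combination has zero coefficients at all degrees in
   [S], yet its own degree lies in [S]. *)
have : kermx A != 0.
  by rewrite kermx_eq0 -row_leq_rank -ltnNge (leq_ltn_trans _ ltSd) ?rank_leq_col.
case/rowV0Pn => u /sub_kermxP uA /negP[]; apply/eqP/rowP => l; rewrite mxE.
apply: freeb; apply: contraTeq isT => fN0.
set f := (X in X != 0) in fN0.
have szf : ((size f).-1 < k)%N.
  rewrite prednK ?size_poly_gt0 // (leq_trans (size_sum _ _ _)) //.
  by apply/bigmax_leqP => i _; rewrite (leq_trans (size_scale_leq _ _)).
have Sf : Ordinal szf \in S by rewrite inE; apply: rootQ.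
move/rowP/(_ (enum_rank_in Sf (Ordinal szf))): uA.
rewrite !mxE => uA0; case/negP: (fN0); rewrite -lead_coef_eq0 lead_coefE.
rewrite {1}/f coef_sum -[X in _ == X]uA0; apply/eqP/eq_bigr => i _.
by rewrite mxE enum_rankK_in //= coefZ.
Qed.

(* If h_l has leading basis vector b_l, replacing row l of the Wronskian by that
   of h_l only rescales the determinant, while the new row vanishes at
   g^m alpha_i for m <= s - d. *)
Lemma subspace_design (F : fieldType) (g : F) s n k d (alpha : 'I_n -> F)
    (b : 'I_d -> {poly F}) (T : 'I_n -> {set 'I_d}) :
  injective (fun p : 'I_s * 'I_n => g ^+ p.1 * alpha p.2) ->
  {in gtn k.+1 &, injective (GRing.exp g)} ->
  (forall l, (size (b l) <= k.+1)%N) ->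
  (forall u : 'I_d -> F, \sum_l u l *: b l = 0 -> forall l, u l = 0) ->
  (0 < d <= s)%N ->
  (forall i l, l \in T i -> exists u : 'I_d -> F,
    [/\ u l != 0, forall l' : 'I_d, (l < l')%N -> u l' = 0
      & forall m : 'I_s, (\sum_l' u l' *: b l').[g ^+ m * alpha i] = 0]) ->
  ((s - d).+1 * \sum_i #|T i| <= d * k)%N.
Proof.
move=> injz injg sb freeb /andP[d_gt0 leds] hT.
set W := folded_wronskian g b.
have WN0 : \det W != 0 by exact: det_folded_wronskian_neq0 injg sb freeb.
have lesd : ((s - d).+1 <= s)%N by lia.
pose z (p : 'I_(s - d).+1 * 'I_n) := g ^+ p.1 * alpha p.2.
have injz' : injective z.
  move=> [m i] [m' i'] eqz.
  have := injz (widen_ord lesd m, i) (widen_ord lesd m', i') eqz.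
  by case=> /val_inj -> ->.
have dvdW (p : 'I_(s - d).+1 * 'I_n) : ('X - (z p)%:P) ^+ #|T p.2| %| \det W.
  case: p => m i; rewrite /z /=.
  have /fin_all_exists[u uP] (l : 'I_d) : exists u : 'I_d -> F,
      l \in T i -> [/\ u l != 0, forall l' : 'I_d, (l < l')%N -> u l' = 0
      & forall m : 'I_s, (\sum_l' u l' *: b l').[g ^+ m * alpha i] = 0].
    have [/hT[u uP]|] := boolP (l \in T i); first by exists u.
    by exists (fun=> 0).
  pose P := \matrix_(l, l') if l \in T i then u l l' else (l == l')%:R.
  have detP : \det P != 0.
    rewrite det_trig.
      apply/prodf_neq0 => l _; rewrite mxE eqxx; case: ifP => [/uP[]//|_].
      exact: oner_neq0.
    apply/is_trig_mxP => l l' ltll'; rewrite mxE; case: ifP => [/uP[_ ul _]|_].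
      exact: ul.
    by rewrite -val_eqE /= ltn_eqF.
  rewrite -(dvdpZr _ _ detP) -mul_polyC -det_map_mx -det_mulmx.
  apply: dvdp_det_rows => l m' lT; have [_ _ ul0] := uP l lT.
  rewrite dvdp_XsubCl /root mxE.
  (* At g^m alpha_i, column m' of the new row takes the value h_l(g^(m + m') alpha_i); m <= s - d
     and m' < d keep the exponent below s. *)
  have ltmm' : (m + m' < s)%N by have := ltn_ord m; have := ltn_ord m'; lia.
  apply/eqP; rewrite -[RHS](ul0 (Ordinal ltmm')) !horner_sum; apply: eq_bigr => l' _.
  rewrite !mxE lT hornerM hornerC horner_comp hornerZ hornerZ hornerX.
  by rewrite mulrA -exprD addnC.
have := dvdp_leq WN0 (prod_exp_XsubC_dvdp injz' dvdW).
rewrite size_prod => [|p _]; last by rewrite expf_neq0 // polyXsubC_eq0.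
have -> : #|[pred _ : 'I_(s - d).+1 * 'I_n | true]| = ((s - d).+1 * n)%N.
  by rewrite -[LHS]/(#|{: 'I_(s - d).+1 * 'I_n}|) card_prod !card_ord.
under eq_bigr => p _ do rewrite size_exp_XsubC -addn1.
rewrite big_split /= sum1_card card_prod !card_ord -addSn addnK.
have -> : (\sum_(p : 'I_(s - d).+1 * 'I_n) #|T p.2| =
           (s - d).+1 * \sum_i #|T i|)%N.
  rewrite -(pair_bigA _ (fun _ i => #|T i|)) /= sum_nat_const card_ord.
  by rewrite mulnC.
move=> ltW; rewrite -ltnS (leq_trans ltW) // size_det_leq // => l m.
rewrite mxE; apply/leq_sizeP => j lekj.
by rewrite coef_comp_scaleX nth_default ?mul0r // (leq_trans (sb l)).
Qed.

(** * Counting agreements by induction along a flag *)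

(** Each nonempty fibre loses one to the predecessor and [#|h @: A|] counts these losses; an empty
    fibre contributes [0.-1 = 0]. *)
Lemma card_pred_fibers (T I : finType) (h : T -> I) (A : {set T}) :
  (#|A|.-1 = \sum_i #|A :&: [set x | h x == i]|.-1 + #|h @: A|.-1)%N.
Proof.
have [->|/set0Pn[x0 Ax0]] := eqVneq A set0.
  rewrite imset0 !cards0 big1 // => i _.
  by rewrite set0I cards0.
have cardA : #|A| = (\sum_i #|A :&: [set x | h x == i]|.-1 + #|h @: A|)%N.
  rewrite -sum1_card (partition_big h predT) //= -sum1_card.
  rewrite [X in (_ + X)%N]big_mkcond -big_split; apply: eq_bigr => i _ /=.
  have -> : (\sum_(x in A | h x == i) 1 = #|A :&: [set x | h x == i]|)%N.
    by rewrite -sum1_card; apply: eq_bigl => x; rewrite !inE.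
  case: imsetP => [[x Ax ->]|nohA].
    rewrite addn1 prednK //; apply/card_gt0P; exists x.
    by rewrite !inE Ax eqxx.
  suff -> : A :&: [set x | h x == i] = set0 by rewrite cards0.
  apply/setP => x; rewrite !inE; apply/andP => -[Ax /eqP hx].
  by apply: nohA; exists x.
have : (0 < #|h @: A|)%N by apply/card_gt0P; exists (h x0); apply: imset_f.
by rewrite cardA; lia.
Qed.

(** [L] stays fixed while [J] shrinks, so that the factor [(s - L).+1] is the same throughout the
    induction on [#|J|]. *)
Lemma agreement_bound (F : finFieldType) (g : F) s n k (alpha : 'I_n -> F)
    (E : 'I_n -> {set {poly_k F}}) L (J : {set {poly_k F}}) :
  (0 < k)%N -> injective (fun p : 'I_s * 'I_n => g ^+ p.1 * alpha p.2) ->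
  {in gtn k &, injective (GRing.exp g)} ->
  (forall i, {in E i &, forall (f h : {poly_k F}) (m : 'I_s),
    (f : {poly F}).[g ^+ m * alpha i] = (h : {poly F}).[g ^+ m * alpha i]}) ->
  (L <= s)%N -> (#|J| <= L.+1)%N ->
  ((s - L).+1 * \sum_i #|J :&: E i|.-1 <= #|J|.-1 * k.-1)%N.
Proof.
case: k E J => // k E J _ injz injg hE leLs; have [c] := ubnP #|J|.
elim: c J => // c IHc J; rewrite ltnS => leJc leJL.
have [leJ1|ltJ1] := leqP #|J| 1.
  rewrite big1 ?muln0 // => i _; have := subset_leq_card (subsetIl J (E i)); lia.
have /card_gt0P[f0 f0J] : (0 < #|J|)%N by lia.
have [Y [sYX freeY spanY]] := exists_free_span [seq f - f0 | f in J].
set d := size Y; set b : 'I_d -> {poly_k.+1 F} := fun l => Y`_l.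
pose co (l : 'I_d) f := coord (in_tuple Y) l (f - f0).
(* [lev f] is the least l such that f - f0 is in the span of the first l elements
   of Y. *)
pose lev f : 'I_d.+1 := inord (\max_(l | co l f != 0) l.+1).
have levE f : lev f = \max_(l | co l f != 0) l.+1 :> nat.
  by rewrite inordK // ltnS; apply/bigmax_leqP => l _; apply: ltn_ord.
have lev_hi f (l : 'I_d) : (lev f <= l)%N -> co l f = 0.
  rewrite levE => lel; apply/eqP; apply: contraLR lel => cN0; rewrite -ltnNge.
  exact: (leq_bigmax_cond (F := fun l : 'I_d => l.+1)).
have lev_top f (l : 'I_d) : lev f = l.+1 :> nat -> co l f != 0.
  rewrite levE => levl; have [|l' cl' maxl'] :=
      @eq_bigmax_cond _ (fun l => co l f != 0) (fun l : 'I_d => l.+1).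
    rewrite lt0n; apply: contra_eq_neq levl => /card0_eq noc.
    by rewrite big_pred0.
  move: cl'; rewrite unfold_in; congr (co _ _ != 0).
  by apply: val_inj; move: maxl'; rewrite levl => -[].
have lev_eq f (l : 'I_d) : co l f != 0 ->
    (forall l' : 'I_d, (l < l')%N -> co l' f = 0) -> lev f = l.+1 :> nat.
  move=> cl chi; apply/eqP; rewrite eqn_leq levE.
  rewrite (leq_bigmax_cond (F := fun l : 'I_d => l.+1)) // andbT.
  apply/bigmax_leqP => l' cl'; rewrite ltnS leqNgt; apply: contra cl' => /chi->.
  exact: eqxx.
have spanJ f : f \in J -> f - f0 = \sum_l co l f *: b l.
  move=> fJ; apply: coord_span; rewrite spanY; apply: memv_span.
  by apply/imageP; exists f.
(* [f0] has level 0, and each basis vector [b l'] is some [f - f0] with f in [J], which puts f on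
   level l' + 1. *)
have lev_onto : lev @: J = [set: 'I_d.+1].
  apply/eqP; rewrite -subTset; apply/subsetP => l _; apply/imsetP.
  case: (unliftP ord0 l) => [l'|] ->.
    have /imageP[f fJ fl'] : b l' \in [seq f - f0 | f in J] by apply/sYX/mem_nth.
    exists f => //; apply: val_inj; rewrite /= /bump /= add1n; apply/esym.
    have cof j : co j f = (l' == j)%:R by rewrite /co -fl'
      (@coord_free _ _ _ (in_tuple Y) _ _ freeY).
    apply: lev_eq => [|l'' ltl']; first by rewrite cof eqxx oner_eq0.
    by rewrite cof -val_eqE /= ltn_eqF.
  exists f0 => //; apply: val_inj; rewrite [RHS]levE big_pred0 // => l'.
  by rewrite /co subrr linear0 eqxx.
(* All d + 1 levels are met, so [#|J|.-1] is d plus the sum of the level sizes, each minus one. *)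
have cardJ := card_pred_fibers lev J.
rewrite lev_onto cardsT card_ord /= in cardJ.
have d_gt0 : (0 < d)%N.
  rewrite lt0n; apply: contraTneq ltJ1 => d0; rewrite -leqNgt -(cards1 f0).
  apply/subset_leq_card/subsetP => f /spanJ; rewrite inE => eqf.
  rewrite -subr_eq0 eqf big1 // => l _.
  by exfalso; move: (ltn_ord l); rewrite [X in (_ < X)%N]d0.
(* Since d > 0, another level is inhabited; hence induction applies to each level. *)
have ltfib l : (#|J :&: [set f | lev f == l]| < #|J|)%N.
  apply/proper_card/properP; split; first exact: subsetIl.
  have [l' nel] : exists l' : 'I_d.+1, l' != l.
    have [->|nel] := eqVneq l ord0; last by exists ord0; rewrite eq_sym.
    by exists ord_max; rewrite -val_eqE /= -lt0n.
  have /imsetP[f fJ l'E] : l' \in lev @: J by rewrite lev_onto inE.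
  by exists f; rewrite // !inE fJ /= -l'E.
(* The levels met by e_i other than the lowest, shifted by one: if f has level l + 1 and h level at
   most l, then f - h has leading basis vector [b l] and vanishes on block i. *)
pose T i := [set l : 'I_d | [exists f in J :&: E i, exists h in J :&: E i,
  (lev f == l.+1 :> nat) && (lev h <= l)%N]].
have cardT i : (#|lev @: (J :&: E i)|.-1 <= #|T i|)%N.
  have [->|/set0Pn[e eJE]] := eqVneq (J :&: E i) set0.
    by rewrite imset0 cards0.
  case: (arg_minnP (fun f => nat_of_ord (lev f)) eJE) => h hJE hmin.
  rewrite (cardsD1 (lev h)) imset_f // add1n /= -(card_imset (T i) (@lift_inj _ ord0)).
  apply/subset_leq_card/subsetP => l /setD1P[lNh /imsetP[f fJE lE]].
  have lthl : (lev h < l)%N.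
    by rewrite ltn_neqAle eq_sym val_eqE lNh lE hmin.
  case: (unliftP ord0 l) lE lthl => [l'|] -> // lE; rewrite lift0 => lthl'.
  apply/imset_f; rewrite inE; apply/exists_inP; exists f => //.
  by apply/exists_inP; exists h => //; rewrite -lE lift0 eqxx -ltnS.
have ledL : (d <= L)%N.
  by apply: leq_trans (_ : #|J|.-1 <= L)%N; [rewrite cardJ leq_addl | lia].
(* As d <= L, the factor s - d + 1 of [subspace_design] is at least s - L + 1. *)
have design : ((s - L).+1 * \sum_i #|T i| <= d * k)%N.
  apply: leq_trans (_ : (s - d).+1 * \sum_i #|T i| <= _)%N.
    by rewrite leq_mul2r; apply/orP; right; lia.
  apply: (subspace_design (b := fun l => b l : {poly F}) injz injg) => //.
  - have /freeP freeY' : free (in_tuple Y) := freeY.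
    move=> u u0; apply: freeY'; apply/val_inj.
    by rewrite -[RHS]u0 raddf_sum.
  - by rewrite d_gt0 (leq_trans ledL).
  move=> i l; rewrite inE => /exists_inP[f /setIP[fJ fE]].
  case/exists_inP=> h /setIP[hJ hEi] /andP[/eqP levf levh].
  exists (fun l' => co l' f - co l' h); split=> [|l' ltl'|m].
  - by rewrite (lev_hi h) // subr0 lev_top.
  - by rewrite !lev_hi ?subrr // ?levf // (leq_trans levh) // ltnW.
  have -> : \sum_l' (co l' f - co l' h) *: (b l' : {poly F}) = val (f - h).
    have -> : f - h = (f - f0) - (h - f0) by rewrite opprB addrA subrK.
    rewrite (spanJ f) // (spanJ h) // -sumrB raddf_sum.
    by apply: eq_bigr => l' _; rewrite -scalerBl.
  by rewrite /= hornerD hornerN (hE i f h fE hEi) subrr.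
have IHfib l : ((s - L).+1 * \sum_i #|J :&: [set f | lev f == l] :&: E i|.-1
                <= #|J :&: [set f | lev f == l]|.-1 * k)%N.
  by apply: IHc; have := ltfib l; lia.
(* The induction hypothesis pays for the agreements inside levels, and [design] for the number of
   levels met by each e_i, minus one. *)
rewrite cardJ mulnDl big_distrl /=.
apply: leq_trans (leq_add _ design); last first.
  by apply: leq_sum => l _; apply: IHfib.
rewrite -big_distrr -mulnDr leq_pmul2l // exchange_big -big_split /=.
apply: leq_sum => i _; rewrite [leqLHS](card_pred_fibers lev) leq_add //.
by apply: leq_sum => l _; rewrite setIAC.
Qed.

(** * From agreements to list decoding *)

(** [gamma] has order q - 1, which is at least N. *)
Lemma generator_exp_inj (F : finFieldType) (gamma : {unit F}) N :
  generator [set: {unit F}] gamma -> (N < #|F|)%N ->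
  {in gtn N &, injective (GRing.exp (val gamma))}.
Proof.
move=> gen ltNF i j; rewrite !inE => ltiN ltjN.
have ord_g : #[gamma]%g = #|F|.-1 by rewrite orderE -(eqP gen) card_finField_unit.
have ltN m : (m < N)%N -> (m < #[gamma]%g)%N by rewrite ord_g; lia.
rewrite -!FinRing.val_unitX => /val_inj/eqP.
by rewrite eq_expg_mod_order !modn_small ?ltN // => /eqP.
Qed.

(** Double counting of the pairs (f, i): each is either a disagreement or an agreement with [y]. *)
Lemma card_dist_agreement (F : finFieldType) s n k (gamma : {unit F})
    (alpha : 'I_n -> F) (y : {ffun 'I_n -> 'rV[F]_s}) (J : {set {poly_k F}})
    (enc := fun f : {poly_k F} => FRS_encode s gamma alpha (val f)) :
  (\sum_(f in J) #|[set i | enc f i != y i]| +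
   \sum_i #|J :&: [set f | enc f i == y i]| = #|J| * n)%N.
Proof.
have -> : (\sum_i #|J :&: [set f | enc f i == y i]| =
           \sum_(f in J) #|[set i | enc f i == y i]|)%N.
  rewrite (eq_bigr (fun i => \sum_(f in J) (enc f i == y i : nat)%N)); last first.
    move=> i _; rewrite -sum1_card big_mkcond [RHS]big_mkcond; apply: eq_bigr => f _.
    by rewrite !inE; case: (f \in J) => //=; case: (_ == _).
  rewrite exchange_big; apply: eq_bigr => f _.
  by rewrite -sum1_card [RHS]big_mkcond; apply: eq_bigr => i _; rewrite inE; case: eqP.
rewrite -big_split -sum_nat_const; apply: eq_bigr => f _ /=.
rewrite addnC -[RHS]card_ord -(cardsC [set i | enc f i == y i]).
by congr (_ + _)%N; apply: eq_card => i; rewrite !inE.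
Qed.

(** Let r be the rate and delta = eps L - (1 - r - eps). If L + 1 polynomials were within the
    radius, sum_i max(|e_i| - 1, 0) would be at least (L r + delta) n, while [agreement_bound] makes
    s - L + 1 times it less than L r s n. Hence delta (s - L + 1) < L (L - 1) r, against the choice
    of s. *)
Lemma FRS_list_decodable (R : realType) (eps : R) (N k s : nat)
    (F : finFieldType) (gamma : {unit F}) (alpha : 'I_(N %/ s) -> F) (L : int) :
  FRS_setting k gamma alpha -> 1 <= L ->
  1 - rate R N k - eps < eps * L%:~R ->
  L%:~R * (L%:~R - 1) * rate R N k
    / (eps * L%:~R - (1 - rate R N k - eps)) + L%:~R - 1 < s%:R ->
  list_decodable (FRS s k gamma alpha) (1 - rate R N k - eps) L.
Proof.
move=> [/andP[k_gt0 ltkN] [s_gt0 dvdsN] ltNF gen app]; case: L => [l|//].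
rewrite lez_nat -pmulrn => l_gt0 ltL lts y; rewrite lez_nat leqNgt.
set n := (N %/ s)%N in alpha app y *; set rho : R := 1 - rate R N k - eps.
pose enc (f : {poly_k F}) := FRS_encode s gamma alpha (val f).
apply/negP => ltl.
(* Each close codeword comes from a close polynomial, so there are at least as many of these;
   exactly l + 1 are kept. *)
have /card_geqP[J0 [uniqJ0 sJ0 J0P]] :
    (l < #|[set f | (#|[set i | enc f i != y i]|%:R <= rho * n%:R)%R]|)%N.
  apply: leq_trans ltl _; apply: leq_trans (leq_imset_card enc _).
  apply/subset_leq_card/subsetP => c; rewrite inE => /andP[/imsetP[f _ ->] cP].
  by apply: imset_f; rewrite inE.
pose J := [set f in J0].
have cardJ : #|J| = l.+1 by rewrite cardsE (card_uniqP uniqJ0).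
have leJ : (\sum_(f in J) #|[set i | enc f i != y i]|)%:R <= l.+1%:R * (rho * n%:R).
  rewrite natr_sum -cardJ mulr_natl -sumr_const; apply: ler_sum => f.
  by rewrite inE => /J0P; rewrite inE.
have nE : N = (s * n)%N by rewrite mulnC divnK.
have n_gt0 : (0 < n)%N by rewrite divn_gt0 // dvdn_leq //; lia.
have r_gt0 : 0 < rate R N k by rewrite divr_gt0 ?ltr0n //; lia.
have rE : k%:R = rate R N k * s%:R * n%:R.
  by rewrite -mulrA -natrM -nE divfK // pnatr_eq0; lia.
set r := rate R N k in r_gt0 rE ltL lts.
rewrite [rho](_ : _ = 1 - r - eps) // in leJ.
have dpos : 0 < eps * l%:R - (1 - r - eps) by rewrite subr_gt0.
have l_ge1 : 1 <= l%:R :> R by rewrite ler1n.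
(* The fraction in the bound on s is nonnegative, so s > l - 1. *)
have lels : (l <= s)%N.
  rewrite -ltnS -(ltr_nat R) mulrSr -ltrBlDr; apply: le_lt_trans lts.
  rewrite -addrA lerDr divr_ge0 ?(ltW dpos) // mulr_ge0 ?(ltW r_gt0) // mulr_ge0 //.
  by rewrite subr_ge0.
have wt : ((s - l).+1 * \sum_i #|J :&: [set f | enc f i == y i]|.-1 <= l * k.-1)%N.
  have := @agreement_bound _ _ _ _ _ _ (fun i => [set f | enc f i == y i]) _ J k_gt0
    app (generator_exp_inj gen (ltn_trans ltkN ltNF)) _ lels.
  rewrite cardJ; apply=> // i f h; rewrite !inE => /eqP fi /eqP hi m.
  have /rowP/(_ m) : enc f i = enc h i by rewrite fi hi.
  by rewrite !ffunE !mxE.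
have := card_dist_agreement gamma alpha y J.
rewrite cardJ -/enc => dist.
have wt1 : (\sum_i #|J :&: [set f | enc f i == y i]| <=
            \sum_i #|J :&: [set f | enc f i == y i]|.-1 + n)%N.
  rewrite -[n in (_ + n)%N]card_ord -sum1_card -big_split; apply: leq_sum => i _ /=.
  lia.
set w := (\sum_i _.-1)%N in wt wt1; set a := (\sum_i _)%N in wt1 dist.
set t := (\sum_(f in J) _)%N in dist leJ.
(* Strict because [k.-1 < k], where k = r s n. *)
have ltw : (s%:R - l%:R + 1) * w%:R < l%:R * (r * s%:R * n%:R) :> R.
  rewrite -rE -natrB // natr1 -!natrM ltr_nat (leq_ltn_trans wt) // ltn_pmul2l //.
  by rewrite prednK.
(* The total agreement is at least (l + 1)(1 - rho) n with 1 - rho = r + eps; removing n leaves this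
   factor. *)
have lew : (l%:R * r + (eps * l%:R - (1 - r - eps))) * n%:R <= w%:R.
  have : (a <= w + n)%N by [].
  rewrite -(ler_nat R) natrD => lea.
  have : (t + a)%:R = (l.+1 * n)%:R :> R by rewrite dist.
  rewrite natrD natrM -!natr1 => distR; move: leJ; rewrite -natr1 => leJ.
  nra.
have ltt : (l%:R * r + (eps * l%:R - (1 - r - eps))) * (s%:R - l%:R + 1) <
    l%:R * r * s%:R.
  have n_gt0' : 0 < n%:R :> R by rewrite ltr0n.
  have les : l%:R <= s%:R :> R by rewrite ler_nat.
  rewrite -(ltr_pM2r n_gt0'); nra.
have : l%:R * (l%:R - 1) * r < (s%:R - l%:R + 1) * (eps * l%:R - (1 - r - eps)).
  by rewrite -(ltr_pdivrMr _ _ dpos); lra.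
nra.
Qed.

(** * Choice of the list size and the folding parameter *)

(** Disposes of eps > 1 - R in the three special cases, where the floor may be 0 and [eps^-1] may be
    below 1. *)
Lemma list_decodable_lt0 (R : realType) n (Sigma : finType)
    (C : {set {ffun 'I_n -> Sigma}}) (rho : R) (L : int) :
  (0 < n)%N -> rho < 0 -> 0 <= L -> list_decodable C rho L.
Proof.
move=> n_gt0 rho_lt0 L_ge0 y; rewrite (_ : [set c in C | _] = set0) ?cards0 //.
apply/setP => c; rewrite !inE; apply/negP => /andP[_]; rewrite leNgt => /negP[].
by rewrite (lt_le_trans _ (ler0n _ _)) // pmulr_llt0 // ltr0n.
Qed.

Lemma FRS_setting_rate (R : realType) (N k s : nat) (F : finFieldType)
    (gamma : {unit F}) (alpha : 'I_(N %/ s) -> F) :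
  FRS_setting k gamma alpha -> (0 < N %/ s)%N /\ 0 < rate R N k < 1.
Proof.
move=> [/andP[k_gt0 ltkN] [s_gt0 dvdsN] _ _ _]; split.
  by rewrite divn_gt0 // dvdn_leq //; lia.
have N_gt0 : 0 < N%:R :> R by rewrite ltr0n; lia.
by rewrite ltr_pdivrMr // mul1r ltr_nat ltkN andbT divr_gt0 // ltr0n.
Qed.

(** Used with v = 1 / eps and q the rate over the denominator. The constant is 3 = 2 + 1: l (l - 1)
    <= (v + 1) v <= 2 v^2, and l - 1 < v <= v^2 c. *)
Lemma folding_parameter_lt (R : realFieldType) (v l q c : R) :
  1 <= v -> 1 <= l -> l - 1 < v -> 0 <= q <= c -> 1 <= c ->
  l * (l - 1) * q + l - 1 < 3 * (v ^+ 2 * c).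
Proof.
move=> v_ge1 l_ge1 ltlv /andP[q_ge0 leqc] c_ge1.
have le1 : l * (l - 1) <= 2 * v ^+ 2 by nra.
have le2 : l * (l - 1) * q <= 2 * v ^+ 2 * c.
  by apply: ler_pM => //; rewrite mulr_ge0 ?subr_ge0 // (le_trans ler01).
have lev : v <= v ^+ 2 * c.
  by rewrite -[leLHS]mulr1 ler_pM ?(le_trans ler01) // expr2 ler_peMr ?(le_trans ler01).
by rewrite -mulrA in le2; lra.
Qed.

(* In the last two items, s = Theta(g(eps)) is c * g(eps) <= s <= C * g(eps)
   with a large enough absolute constant c and an arbitrary constant C >= c. *)
Theorem corollary2p21 (R : realType) :
  [/\ (forall (eps : R) (N k s : nat) (F : finFieldType) (gamma : {unit F})
          (alpha : 'I_(N %/ s) -> F) (L : int),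
        0 < eps -> FRS_setting k gamma alpha ->
        1 <= L ->
        (1 - rate R N k - eps) / eps < L%:~R ->
        L%:~R * (L%:~R - 1) * rate R N k
            / (eps * L%:~R - (1 - rate R N k - eps)) + L%:~R - 1 < s%:R ->
        list_decodable (FRS s k gamma alpha) (1 - rate R N k - eps) L),
      (exists stilde : R -> R -> R,
        forall (eps : R) (N k s : nat) (F : finFieldType) (gamma : {unit F})
          (alpha : 'I_(N %/ s) -> F),
        0 < eps -> FRS_setting k gamma alpha ->
        stilde (rate R N k) eps < s%:R ->
        list_decodable (FRS s k gamma alpha) (1 - rate R N k - eps)
          (Num.floor ((1 - rate R N k) / eps))),
      (exists2 c : R, 0 < c &
        forall (C : R), c <= C ->
        forall (eps : R) (N k s : nat) (F : finFieldType) (gamma : {unit F})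
          (alpha : 'I_(N %/ s) -> F),
        0 < eps -> FRS_setting k gamma alpha ->
        c * (1 / eps ^+ 3) <= s%:R <= C * (1 / eps ^+ 3) ->
        list_decodable (FRS s k gamma alpha) (1 - rate R N k - eps)
          (Num.ceil ((1 - rate R N k) / eps)))
    & (exists2 c : R, 0 < c &
        forall (C : R), c <= C ->
        forall (eps : R) (N k s : nat) (F : finFieldType) (gamma : {unit F})
          (alpha : 'I_(N %/ s) -> F),
        0 < eps -> FRS_setting k gamma alpha ->
        c * (1 / eps ^+ 2) <= s%:R <= C * (1 / eps ^+ 2) ->
        list_decodable (FRS s k gamma alpha) (1 - rate R N k - eps)
          (Num.ceil (1 / eps)))].
Proof.

split.
- move=> eps N k s F gamma alpha L eps_gt0 set_ L_ge1 ltL lts.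
  by apply: FRS_list_decodable => //; rewrite mulrC -ltr_pdivrMr.
(* The threshold of the first item at L = floor((1 - R) / eps). *)
- exists (fun r eps => let L := (Num.floor ((1 - r) / eps))%:~R in
    L * (L - 1) * r / (eps * L - (1 - r - eps)) + L - 1).
  move=> eps N k s F gamma alpha eps_gt0 set_ /= lts.
  have [n_gt0 /andP[r_gt0 r_lt1]] := FRS_setting_rate R set_.
  have [rho_lt0|rho_ge0] := ltP (1 - rate R N k - eps) 0.
    apply: list_decodable_lt0 => //; rewrite floor_ge0 divr_ge0 ?(ltW eps_gt0) //.
    lra.
  apply: FRS_list_decodable => //.
    by rewrite -gtz0_ge1 floor_gt0 ler_pdivlMr //; lra.
  (* With x = (1 - R) / eps, the condition on L reads L > x - 1, which the floor satisfies. *)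
  have := floorD1_gt ((1 - rate R N k) / eps).
  by rewrite ltr_pdivrMr // rmorphD rmorph1; lra.
(* Here eps L >= 1 - R, so the denominator is at least eps and the quotient R over it at most 1 /
   eps: [folding_parameter_lt] applies with v = c = 1 / eps. *)
- exists 3 => // C _ eps N k s F gamma alpha eps_gt0 set_ /andP[les _].
  have [n_gt0 /andP[r_gt0 r_lt1]] := FRS_setting_rate R set_.
  have L_gt0 : 0 < Num.ceil ((1 - rate R N k) / eps).
    by rewrite ceil_gt0 divr_gt0 //; lra.
  have [rho_lt0|rho_ge0] := ltP (1 - rate R N k - eps) 0.
    by apply: list_decodable_lt0 => //; apply: ltW.
  have L_ge1 : 1 <= (Num.ceil ((1 - rate R N k) / eps))%:~R :> R
    by rewrite ler1z -gtz0_ge1.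
  have ltL := ceilB1_lt ((1 - rate R N k) / eps).
  have leL := ceil_ge ((1 - rate R N k) / eps).
  rewrite rmorphB rmorph1 /= in ltL; rewrite ler_pdivrMr // in leL.
  set L := Num.ceil _ in L_gt0 L_ge1 ltL leL *.
  set r := rate R N k in r_gt0 r_lt1 rho_ge0 ltL leL *.
  apply: FRS_list_decodable; rewrite -/r ?gtz0_ge1 //; first by lra.
  apply: lt_le_trans les; rewrite -[_ * r / _]mulrA.
  have -> : 1 / eps ^+ 3 = eps^-1 ^+ 2 * eps^-1 by field; rewrite gt_eqF.
  have v_ge1 : 1 <= eps^-1 by rewrite invf_ge1 //; lra.
  apply: folding_parameter_lt => //.
    by apply: lt_le_trans ltL _; rewrite ler_pdivrMr // mulVf ?gt_eqF //; lra.
  rewrite divr_ge0 ?(ltW r_gt0) //=; last by lra.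
  by rewrite -[leRHS]mul1r ler_pM ?lef_pV2 ?posrE ?invr_ge0 //; lra.
(* Here eps L >= 1, so the denominator is at least R and the quotient at most 1:
   [folding_parameter_lt] applies with v = 1 / eps and c = 1. *)
- exists 3 => // C _ eps N k s F gamma alpha eps_gt0 set_ /andP[les _].
  have [n_gt0 /andP[r_gt0 r_lt1]] := FRS_setting_rate R set_.
  have L_gt0 : 0 < Num.ceil (1 / eps) by rewrite ceil_gt0 divr_gt0.
  have [rho_lt0|rho_ge0] := ltP (1 - rate R N k - eps) 0.
    by apply: list_decodable_lt0 => //; apply: ltW.
  have L_ge1 : 1 <= (Num.ceil (1 / eps))%:~R :> R
    by rewrite ler1z -gtz0_ge1.
  have ltL := ceilB1_lt (1 / eps); have leL := ceil_ge (1 / eps).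
  rewrite rmorphB rmorph1 /= in ltL; rewrite ler_pdivrMr // in leL.
  set L := Num.ceil _ in L_gt0 L_ge1 ltL leL *.
  set r := rate R N k in r_gt0 r_lt1 rho_ge0 *.
  apply: FRS_list_decodable; rewrite -/r ?gtz0_ge1 //; first by lra.
  apply: lt_le_trans les; rewrite -[_ * r / _]mulrA.
  have -> : 1 / eps ^+ 2 = eps^-1 ^+ 2 * 1 by field; rewrite gt_eqF.
  have v_ge1 : 1 <= eps^-1 by rewrite invf_ge1 //; lra.
  apply: folding_parameter_lt => //; first by rewrite -[eps^-1]mul1r.
  rewrite divr_ge0 ?(ltW r_gt0) //=; last by lra.
  by rewrite ler_pdivrMr ?mul1r; lra.
Qed.
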